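(* Let $r\ge 2$ and $s\ge 3$ be integers. Then $$ \mathrm{gp}(P_r\,\square\,C_s) = \begin{cases} 3; & r = 2 \text{ and } s = 3,\\ 5; & r \ge 5 \text{ and } (s=7 \text{ or } s\ge 9),\\ 4; & \text{otherwise}. \end{cases} $$
   Context: For a connected graph $G$ with shortest-path distance $d_G$, a set $S\subseteq V(G)$ is a general position set if $d_G(u,v)\ne d_G(u,w)+d_G(w,v)$ holds for every choice of three distinct vertices $u,v,w\in S$ (in every role assignment), i.e. no three distinct vertices of $S$ lie on a common geodesic. The general position number $\mathrm{gp}(G)$ is the maximum cardinality of a general position set of $G$. $P_r$ is the path on $r$ vertices and $C_s$ is the cycle on $s$ vertices. The Cartesian product $G\,\square\,H$ has vertex set $V(G)\times V(H)$, with $(g,h)$ and $(g',h')$ adjacent if either $gg'\in E(G)$ and $h=h'$, or $g=g'$ and $hh'\in E(H)$. *)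

(* Defs.v *)
From mathcomp Require Import all_boot.

Set Implicit Arguments.
Unset Strict Implicit.
Unset Printing Implicit Defensive.

Record sgraph := SGraph {
  vertex :> finType;
  adj : rel vertex;
  adj_sym : symmetric adj;
  adj_irrefl : irreflexive adj }.

Section GeneralPosition.

Variable G : sgraph.
Implicit Types (x y u v w : G) (S : {set G}).

Definition has_walk n x y : bool :=
  [exists p : n.-tuple G, path (@adj G) x p && (last x p == y)].

(* The least length of a walk from x to y. A shortest walk visits each vertex
   at most once, so it suffices to search below #|G|; on vertices in different
   components the value is #|G| (see distP and dist_disconnected). *)
Definition dist x y : nat := find (fun n => has_walk n x y) (iota 0 #|G|).

Definition gp_set S : bool :=
  [forall u in S, forall v in S, forall w in S,
     [&& u != v, u != w & v != w] ==> (dist u v != dist u w + dist w v)].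

Definition gp : nat := \max_(S : {set G} | gp_set S) #|S|.

Lemma has_walkP n x y :
  reflect (exists p, [/\ size p = n, path (@adj G) x p & last x p = y])
          (has_walk n x y).
Proof.
apply: (iffP existsP) => [[p /andP[pp /eqP lp]]|[p [sp pp lp]]].
  by exists p; rewrite size_tuple.
by exists (Tuple (introT eqP sp)); rewrite /= pp lp eqxx.
Qed.

Lemma has_walk_short x y :
  connect (@adj G) x y -> exists2 n, n < #|G| & has_walk n x y.
Proof.
case/connectP=> p pp ->; case/shortenP: pp => q qp qu _.
exists (size q); last by apply/has_walkP; exists q.
by have := card_uniqP qu; rewrite /= => <-; apply: max_card.
Qed.

Lemma distP x y : connect (@adj G) x y ->
  has_walk (dist x y) x y /\ (forall n, has_walk n x y -> dist x y <= n).
Proof.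
case/has_walk_short=> m mG wm.
have hs : has (fun n => has_walk n x y) (iota 0 #|G|).
  by apply/hasP; exists m; rewrite // mem_iota.
have dG : dist x y < #|G| by rewrite has_find size_iota in hs.
split=> [|n wn]; first by have := nth_find 0 hs; rewrite nth_iota.
rewrite leqNgt; apply/negP => nd.
by have := before_find 0 nd; rewrite nth_iota ?wn // (ltn_trans nd dG).
Qed.

Lemma dist_disconnected x y : ~~ connect (@adj G) x y -> dist x y = #|G|.
Proof.
move=> nc; rewrite /dist hasNfind ?size_iota //; apply/hasPn => n _.
by apply: contra nc => /has_walkP[p [_ pp lp]]; apply/connectP; exists p.
Qed.

End GeneralPosition.

Section PathGraph.

Variable r : nat.

Definition path_adj : rel 'I_r := fun i j => (i.+1 == j) || (j.+1 == i).

Fact path_adj_sym : symmetric path_adj.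
Proof. by move=> i j; rewrite /path_adj orbC. Qed.

Fact path_adj_irrefl : irreflexive path_adj.
Proof. by move=> i; rewrite /path_adj orbb gtn_eqF. Qed.

Definition path_graph : sgraph := SGraph path_adj_sym path_adj_irrefl.

End PathGraph.

Section CycleGraph.

Variable s : nat.

(* The conjunct i != j only matters when s = 1; the s-cycle is meant for
   3 <= s, and for smaller s this is a complete graph. *)
Definition cycle_adj : rel 'I_s :=
  fun i j => (i != j) && ((i.+1 %% s == j) || (j.+1 %% s == i)).

Fact cycle_adj_sym : symmetric cycle_adj.
Proof. by move=> i j; rewrite /cycle_adj eq_sym orbC. Qed.

Fact cycle_adj_irrefl : irreflexive cycle_adj.
Proof. by move=> i; rewrite /cycle_adj eqxx. Qed.

Definition cycle_graph : sgraph := SGraph cycle_adj_sym cycle_adj_irrefl.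

End CycleGraph.

Section CartesianProduct.

Variables G H : sgraph.

Definition cart_adj : rel (G * H)%type := fun a b =>
  (adj a.1 b.1 && (a.2 == b.2)) || ((a.1 == b.1) && adj a.2 b.2).

Fact cart_adj_sym : symmetric cart_adj.
Proof.
move=> a b; rewrite /cart_adj (adj_sym a.1) (adj_sym a.2).
by rewrite (eq_sym a.1) (eq_sym a.2).
Qed.

Fact cart_adj_irrefl : irreflexive cart_adj.
Proof. by move=> a; rewrite /cart_adj !adj_irrefl andbF. Qed.

Definition cart_prod : sgraph := SGraph cart_adj_sym cart_adj_irrefl.

End CartesianProduct.

(* Main.v *)
Require Import Defs.
From mathcomp Require Import all_boot zify.

Set Implicit Arguments.
Unset Strict Implicit.
Unset Printing Implicit Defensive.

(** In the cylinder, the distance is the difference of the layers plus the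
    cyclic distance of the angles ([dist_cylinder]). Hence w lies on a geodesic
    from u to v exactly when its layer is between theirs and its angle is
    between theirs on the cycle. So list a general position set by increasing
    layer, with angles c_1, c_2, and so on: whenever i < j < k, the angle c_j
    is not between c_i and c_k on the cycle ([gp_chain_betweenless]). When two
    consecutive points share their layer, their order is arbitrary, and both
    orders give such a condition ([gp_chain3]).

    That c_j is not between c_i and c_k means that the arc from c_i to c_k
    avoiding c_j is shorter than s/2. For five angles this is very rigid
    ([five_on_cycle]): up to rotation and reflection they occur around the cycle
    in the order c_1, c_4, c_3, c_2, c_5, and the arc from c_2 through c_5 and
    c_1 to c_4, the arc from c_3 through c_2 to c_5, and the arc from c_1
    through c_4 to c_3 are shorter than s/2. This has three consequences.
    - Integer arcs with these lengths exist only for s = 7 and s >= 9.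
    - Interchanging two consecutive angles always breaks the pattern, so the
      five layers are distinct and r >= 5 ([gp_chain_five]).
    - Six points are impossible ([no_gp_chain_six]): the pattern for
      p_1, p_2, p_3, p_4, p_5 puts c_1 between c_4 and c_5, while the pattern
      for p_1, p_2, p_4, p_5, p_6 puts c_5 between c_1 and c_4; so c_1 = c_5,
      and then c_5 is between c_1 and c_6.

    On a triangle no angle is between two others, which makes four points occupy
    at least three layers ([gp_chain_four_triangle]). The lower bounds are
    explicit sets; the one with five points realizes the pattern above in five
    consecutive layers ([gp_ge5]). *)

(** * Distances in the cylinder *)

Section DistanceCertificate.
Variables (G : sgraph) (y : G) (D : G -> nat).

(** A local certificate that D is the distance to y: D vanishes exactly at y,
    changes by at most one along an edge, and decreases along some edge. *)
Definition dist_certificate : Prop :=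
  [/\ forall x, (D x == 0) = (x == y),
      forall u v, adj u v -> D u <= (D v).+1 &
      forall u, 0 < D u -> exists2 v, adj u v & D u = (D v).+1].

(** Descending from x reaches y in D x steps, and no walk can descend faster. *)
Lemma dist_certificateE x : dist_certificate -> dist x y = D x.
Proof.
case=> D0 Dlip Ddesc.
have down n : forall u, D u = n -> has_walk n u y.
  elim: n => [|n IHn] u Du.
    by apply/has_walkP; exists [::]; split=> //=; apply/eqP; rewrite -D0 Du.
  have [|v uv] := Ddesc u; first by rewrite Du.
  rewrite Du => -[/esym/IHn/has_walkP[p [sp pp lp]]].
  by apply/has_walkP; exists (v :: p); rewrite /= sp uv.
have up n u : has_walk n u y -> D u <= n.
  case/has_walkP=> p [<-]; elim: p u => [|v p IHp] u /=.
    by move=> _ ->; rewrite leqn0 D0.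
  case/andP=> uv pp lp; apply: leq_trans (Dlip _ _ uv) _.
  by rewrite ltnS IHp.
have wx := down _ _ (erefl (D x)).
have cxy : connect (@adj G) x y.
  by case/has_walkP: wx => p [_ pp lp]; apply/connectP; exists p.
have [wd least] := distP cxy.
by apply/eqP; rewrite eqn_leq least // up.
Qed.

End DistanceCertificate.

Definition pdist a b := (a - b) + (b - a).
Definition cdist s a b := minn (pdist a b) (s - pdist a b).

Lemma path_certificate r (j : 'I_r) :
  @dist_certificate (path_graph r) j (fun i => pdist (i : 'I_r) j).
Proof.
rewrite /pdist; split=> [i|i k|i]; first by rewrite -val_eqE /=; lia.
  by rewrite /= /path_adj => /orP[]/eqP /= <-; lia.
have ir := ltn_ord i; have jr := ltn_ord j.
have [ij|ji|->] := ltngtP i j => Dpos; [| |lia].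
  have h : i.+1 < r by lia.
  by exists (Ordinal h); rewrite /= /path_adj /= ?eqxx //; lia.
have h : i.-1 < r by lia.
by exists (Ordinal h); rewrite /= /path_adj /=; lia.
Qed.

Lemma modS_lt i s : i < s -> i.+1 %% s = if i.+1 == s then 0 else i.+1.
Proof.
by rewrite leq_eqVlt; case: eqP => [-> _|_ /= /modn_small //]; rewrite modnn.
Qed.

Lemma cycle_certificate s (b : 'I_s) : 3 <= s ->
  @dist_certificate (cycle_graph s) b (fun a => cdist s (a : 'I_s) b).
Proof.
rewrite /cdist /pdist => s3; have bs := ltn_ord b.
split=> [a|a c|a].
- by have := ltn_ord a; rewrite -val_eqE /=; lia.
- have as_ := ltn_ord a; have cs := ltn_ord c.
  rewrite /= /cycle_adj => /andP[_]; rewrite !modS_lt //.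
  by case/orP; case: (_ =P s) => ? /eqP /= <-; lia.
have as_ := ltn_ord a; move=> Dpos.
have next_lt : (if a.+1 == s then 0 else a.+1) < s by case: (_ =P _); lia.
have prev_lt : (if a == 0 :> nat then s.-1 else a.-1) < s.
  by case: (_ =P _); lia.
have next_adj : cycle_adj a (Ordinal next_lt).
  by rewrite /cycle_adj -!val_eqE /= modS_lt // eqxx andbT; case: (_ =P s); lia.
have prev_adj : cycle_adj a (Ordinal prev_lt).
  rewrite /cycle_adj -!val_eqE /= (modS_lt prev_lt).
  by case: (_ =P 0) => ?; case: (_ =P s) => ?; lia.
(* the condition says that increasing the angle is a shortest way to b *)
have [next_closer|] := boolP ((a < b) && (2 * (b - a) <= s) ||
                             ((b < a) && (s < 2 * (a - b)))).
  by exists (Ordinal next_lt) => //=; case: (_ =P s); lia.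
by move=> prev_closer; exists (Ordinal prev_lt) => //=; case: (_ =P 0); lia.
Qed.

(** Every edge of a Cartesian product moves one coordinate along an edge of its
    factor, so certificates for the factors add up. *)
Lemma cart_certificate (G H : sgraph) (y : cart_prod G H)
    (DG : G -> nat) (DH : H -> nat) :
  dist_certificate y.1 DG -> dist_certificate y.2 DH ->
  @dist_certificate (cart_prod G H) y
    (fun x : cart_prod G H => DG x.1 + DH x.2).
Proof.
case: y => y1 y2 /= [G0 Glip Gdesc] [H0 Hlip Hdesc].
split=> [[x1 x2]|[u1 u2] [v1 v2]|[u1 u2]] /=.
- by rewrite addn_eq0 G0 H0.
- rewrite /cart_adj /= => /orP[/andP[/Glip uv /eqP->]|/andP[/eqP-> /Hlip uv]].
    by rewrite -addSn leq_add2r.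
  by rewrite -addnS leq_add2l.
have [z|/Gdesc[v uv Duv] _] := posnP (DG u1).
  rewrite z => /Hdesc[v uv Duv].
  by exists (u1, v); rewrite /= /cart_adj /= ?eqxx ?uv ?orbT // z.
by exists (v, u2); rewrite /= /cart_adj /= ?eqxx ?uv // Duv.
Qed.

Notation cylinder r s := (cart_prod (path_graph r) (cycle_graph s)).

Definition cyl_dist s (p q : nat * nat) := pdist p.1 q.1 + cdist s p.2 q.2.

Definition coords r s (u : cylinder r s) : nat * nat :=
  (nat_of_ord (u.1 : 'I_r), nat_of_ord (u.2 : 'I_s)).

Lemma dist_cylinder r s (u v : cylinder r s) : 3 <= s ->
  dist u v = cyl_dist s (coords u) (coords v).
Proof.
move=> s3; case: v => i b.
have cert := @cart_certificate (path_graph r) (cycle_graph s) (i, b) _ _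
  (path_certificate i) (cycle_certificate b s3).
exact: (dist_certificateE u cert).
Qed.

Lemma coords_inj r s : injective (@coords r s).
Proof. by case=> u1 u2 [v1 v2] [] /= /val_inj-> /val_inj->. Qed.

(** Stated for pairs of natural numbers instead of vertices, so that instances
    are settled by arithmetic alone. *)
Definition gen_pos s (t : seq (nat * nat)) : Prop :=
  forall u v w, u \in t -> v \in t -> w \in t ->
    u != v -> u != w -> v != w ->
    cyl_dist s u v != cyl_dist s u w + cyl_dist s w v.

Definition in_grid r s (p : nat * nat) := (p.1 < r) && (p.2 < s).

Lemma coords_in_grid r s (u : cylinder r s) : in_grid r s (coords u).
Proof. by rewrite /in_grid /= !ltn_ord. Qed.

Definition layer_le : rel (nat * nat) := fun p q => p.1 <= q.1.

Lemma layer_le_trans : transitive layer_le.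
Proof. by move=> q p w; apply: leq_trans. Qed.

Definition gp_chain r s t : Prop :=
  [/\ uniq t, all (in_grid r s) t, sorted layer_le t & gen_pos s t].

Lemma gen_pos_sub s t t' : {subset t' <= t} -> gen_pos s t -> gen_pos s t'.
Proof. by move=> st gt u v w /st ut /st vt /st wt; apply: gt. Qed.

Lemma gp_chain_subseq r s t t' :
  subseq t' t -> gp_chain r s t -> gp_chain r s t'.
Proof.
move=> st [ut gridt lt gt]; have sub := mem_subseq st.
split; [exact: subseq_uniq ut | | | exact: gen_pos_sub gt].
  by apply/allP=> p /sub; apply: (allP gridt).
exact: (subseq_sorted layer_le_trans st).
Qed.

Lemma gp_chain_mask r s m t : gp_chain r s t -> gp_chain r s (mask m t).
Proof. exact: gp_chain_subseq (mask_subseq m t). Qed.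

(** A larger general position set, sorted by layer and truncated, would give a
    chain of exactly n.+1 points. *)
Lemma gp_cylinder_le r s n : 3 <= s ->
  (forall t, gp_chain r s t -> size t <> n.+1) -> gp (cylinder r s) <= n.
Proof.
move=> s3 no_chain; apply/bigmax_leqP => S gpS; rewrite leqNgt; apply/negP.
pose t := sort layer_le [seq coords u | u <- enum S].
have size_t : size t = #|S| by rewrite size_sort size_map cardE.
have chain_t : gp_chain r s t.
  split.
  - by rewrite sort_uniq map_inj_uniq ?enum_uniq //; apply: coords_inj.
  - by rewrite all_sort all_map; apply/allP=> u _; apply: coords_in_grid.
  - by apply: sort_sorted => p q; apply: leq_total.
  have memt p : p \in t -> exists2 u, u \in S & p = coords u.
    by rewrite mem_sort => /mapP[u]; rewrite mem_enum; exists u.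
  move=> _ _ _ /memt[u uS ->] /memt[v vS ->] /memt[w wS ->].
  rewrite !(inj_eq (@coords_inj r s)) -!dist_cylinder // => uv uw vw.
  move/forall_inP/(_ u uS)/forall_inP/(_ v vS)/forall_inP/(_ w wS): gpS.
  by rewrite uv uw vw.
rewrite -size_t => lt_n_t.
apply: (no_chain (take n.+1 t)); last by rewrite size_takel.
exact: (gp_chain_subseq (take_subseq _ _)).
Qed.

Lemma gp_cylinder_ge r s t : 3 <= s ->
  uniq t -> all (in_grid r s) t -> gen_pos s t -> size t <= gp (cylinder r s).
Proof.
move=> s3 ut gridt gt.
pose S := [set u : cylinder r s | coords u \in t].
have gpS : gp_set S.
  apply/forall_inP=> u; rewrite inE => uS; apply/forall_inP=> v.
  rewrite inE => vS; apply/forall_inP=> w; rewrite inE => wS.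
  apply/implyP; rewrite -!(inj_eq (@coords_inj r s)) => /and3P[uv uw vw].
  by rewrite !dist_cylinder //; apply: gt.
apply: leq_trans (leq_bigmax_cond _ gpS).
rewrite cardE -(size_map (@coords r s)).
apply: uniq_leq_size => // -[i a] pt; have /andP[ir as_] := allP gridt _ pt.
apply/mapP; exists (Ordinal ir, Ordinal as_) => //.
by rewrite mem_enum inE.
Qed.

(** * Betweenness on the cycle *)

Definition between s a b c := cdist s a c == cdist s a b + cdist s b c.

Lemma cdistC s a b : cdist s a b = cdist s b a.
Proof. by rewrite /cdist /pdist addnC. Qed.

Lemma cdist_le s a b : a <= b -> cdist s a b = minn (b - a) (s - (b - a)).
Proof. by move=> ab; rewrite /cdist /pdist (eqP ab). Qed.

Lemma betweenC s a b c : between s a b c = between s c b a.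
Proof. by rewrite /between cdistC addnC (cdistC s a) (cdistC s b). Qed.

(** The points a and c cut the cycle into two arcs, one of which contains b. The
    other one, of length s - (c - a) when b is on the segment from a to c and of
    length c - a otherwise, has to be the only geodesic from a to c. *)
Lemma not_between_le s a b c : a <= c <= s -> b <= s -> ~~ between s a b c ->
  (a < b < c) && (s < 2 * (c - a)) \/
  (b < a \/ c < b) /\ 2 * (c - a) < s.
Proof.
rewrite /between => /andP[ac cs] bs.
rewrite (cdist_le _ ac).
have [ab|/ltnW ba] := leqP a b;
  [rewrite (cdist_le _ ab) | rewrite cdistC (cdist_le _ ba)];
  (have [bc|/ltnW cb] := leqP b c;
    [rewrite (cdist_le _ bc) | rewrite (cdistC s b) (cdist_le _ cb)]);
  have [?|?] := leqP s (2 * (c - a)); lia.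
Qed.

Lemma between_end s a b c : (b == a) || (b == c) -> between s a b c.
Proof. by rewrite /between /cdist /pdist => /orP[]/eqP->; lia. Qed.

(** The last two conclusions come from interchanging two points that share their
    layer: the list stays sorted. *)
Lemma gp_chain3 r s (u v w : nat * nat) : gp_chain r s [:: u; v; w] ->
  [/\ ~~ between s u.2 v.2 w.2,
      u.1 = v.1 -> ~~ between s v.2 u.2 w.2 &
      v.1 = w.1 -> ~~ between s u.2 w.2 v.2].
Proof.
case=> /=; rewrite !inE !negb_or !andbT => /andP[/andP[uv uw] vw] _.
case/andP; rewrite /layer_le => luv lvw gp3.
have [u3 v3 w3] :
    [/\ u \in [:: u; v; w], v \in [:: u; v; w] & w \in [:: u; v; w]].
  by rewrite !inE !eqxx !orbT.
have [vu wv] : v != u /\ w != v by rewrite eq_sym uv eq_sym.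
have := gp3 u w v u3 w3 v3 uw uv wv.
have := gp3 v w u v3 w3 u3 vw vu; rewrite eq_sym => /(_ uw).
have := gp3 u v w u3 v3 w3 uv uw vw.
rewrite /cyl_dist /between /pdist.
move: (cdist s) => d; clear -luv lvw.
by split=> [|e|e]; lia.
Qed.

Fixpoint betweenless s cs :=
  if cs is a :: cs' then
    pairwise (fun b c => ~~ between s a b c) cs' && betweenless s cs'
  else true.

Lemma gp_chain_betweenless r s t :
  gp_chain r s t -> betweenless s [seq p.2 | p <- t].
Proof.
elim: t => //= u t IHt ch; apply/andP; split; last first.
  exact: IHt (gp_chain_subseq (subseq_cons t u) ch).
have {IHt}: forall v w, subseq [:: v; w] t -> ~~ between s u.2 v.2 w.2.
  move=> v w vw; have [] // := @gp_chain3 r s u v w.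
  by apply: gp_chain_subseq ch; rewrite /= eqxx.
elim: t {ch} => //= v t IHt H; apply/andP; split.
  rewrite all_map; apply/allP=> w wt; apply: H.
  by rewrite /= eqxx sub1seq.
apply: IHt => w z wz; apply: H.
exact: subseq_trans wz (subseq_cons _ _).
Qed.

(** Rotate c1 to 0, then reflect if the image of c5 is below s/2. The value s
    stands for a second copy of 0: it allows c5 = c1, where c5 is sent to s.
    This is why c1 itself is represented by the literal 0 and not by f c1. *)
Lemma cyclic_normalize s c1 c5 : c1 < s -> c5 < s -> exists f : nat -> nat,
  [/\ s <= 2 * f c5, forall a, a < s -> f a <= s,
      forall a, a < s -> cdist s 0 (f a) = cdist s c1 a &
      forall a b, a < s -> b < s -> cdist s (f a) (f b) = cdist s a b].
Proof.
move=> h1 h5; pose rho a := if c1 <= a then a - c1 else a + s - c1.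
have rho_le a : a < s -> rho a <= s by rewrite /rho; case: (leqP c1 a); lia.
have A a : a < s -> cdist s 0 (rho a) = cdist s c1 a.
  by move=> ?; rewrite /rho /cdist /pdist; case: (leqP c1 a); lia.
have B a b : a < s -> b < s -> cdist s (rho a) (rho b) = cdist s a b.
  move=> ? ?; rewrite /rho /cdist /pdist.
  by case: (leqP c1 a); case: (leqP c1 b); lia.
clearbody rho.
have [h|h] := leqP s (2 * rho c5); [exists rho | exists (fun a => s - rho a)];
  split=> // [|a as_|a as_|a b as_ bs].
- lia.
- lia.
- by rewrite -A // /cdist /pdist; have := rho_le a as_; lia.
- rewrite -(B a b) // /cdist.
  have := rho_le a as_; have := rho_le b bs => rb ra.
  by have -> : pdist (s - rho a) (s - rho b) = pdist (rho a) (rho b)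
    by rewrite /pdist; lia.
Qed.

(** As c5 >= s/2, the middle points lie on the segment from 0 to c5. The
    length of c5 - c2 tells on which side of c2 both c3 and c4 are, and the
    length of c4 tells on which side of c4 both c2 and c3 are; so the middle
    points are in monotone order. The increasing order would make both
    c3 and c5 - c3 longer than s/2. *)
Lemma five_from_zero s c2 c3 c4 c5 :
  [/\ c2 <= s, c3 <= s, c4 <= s & c5 <= s] -> s <= 2 * c5 ->
  betweenless s [:: 0; c2; c3; c4; c5] ->
  [/\ 0 < c4 < c3, c3 < c2 < c5, s < 2 * (c2 - c4), 2 * c3 < s
     & 2 * (c5 - c3) < s].
Proof.
case=> h2 h3 h4 h5 c5_far; rewrite /= !andbT.
case/and3P=> /and3P[/and3P[n123 n124 n125] /andP[n134 n135] n145].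
case/andP=> /andP[n234 n235] n245 n345.
have far x : x <= s -> ~~ between s 0 x c5 -> 0 < x < c5.
  by move=> xs /(not_between_le (a := 0) h5 xs); clear -c5_far; lia.
have p2 := far _ h2 n125; have p3 := far _ h3 n135; have p4 := far _ h4 n145.
have h25 : c2 <= c5 <= s by rewrite h5 andbT; case/andP: p2 => _ /ltnW.
have h35 : c3 <= c5 <= s by rewrite h5 andbT; case/andP: p3 => _ /ltnW.
have f123 := not_between_le (a:=0) h3 h2 n123.
have f124 := not_between_le (a:=0) h4 h2 n124.
have f134 := not_between_le (a:=0) h4 h3 n134.
have f235 := not_between_le h25 h3 n235.
have f245 := not_between_le h25 h4 n245.
have f345 := not_between_le h35 h4 n345.
clear n123 n124 n125 n134 n135 n145 n235 n245 n345.
have [h24|/ltnW h42] := leqP c2 c4.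
  have h24s : c2 <= c4 <= s by rewrite h24.
  have f234 := not_between_le h24s h3 n234.
  exfalso; lia.
have h42s : c4 <= c2 <= s by rewrite h42.
rewrite betweenC in n234.
have f234 := not_between_le h42s h3 n234.
split; lia.
Qed.

(** The order c1, c4, c3, c2, c5 around the cycle, expressed by betweenness on
    its short arcs so as to be independent of the chosen rotation and
    reflection. The restriction on s is the solvability over the integers of the
    inequalities in [five_from_zero]. *)
Lemma five_on_cycle s c1 c2 c3 c4 c5 : all (gtn s) [:: c1; c2; c3; c4; c5] ->
  betweenless s [:: c1; c2; c3; c4; c5] ->
  [/\ (s == 7) || (9 <= s),
      between s c4 c1 c5,
      between s c2 c1 c4 && between s c2 c5 c4,
      between s c3 c2 c5 &
      between s c1 c4 c3].
Proof.
rewrite /= andbT => /and5P[s1 s2 s3 s4 s5].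
have [f [far f_le f1 f2]] := cyclic_normalize s1 s5.
have fb1 a b : a < s -> b < s -> between s c1 a b = between s 0 (f a) (f b).
  by move=> ? ?; rewrite /between !f1 ?f2.
have fb1' a b : a < s -> b < s -> between s a c1 b = between s (f a) 0 (f b).
  by move=> ? ?; rewrite /between !(cdistC s _ c1) !(cdistC s _ 0) !f1 ?f2.
have fb a b c : a < s -> b < s -> c < s ->
    between s a b c = between s (f a) (f b) (f c).
  by move=> ? ? ?; rewrite /between !f2.
rewrite (fb1 c2 c3) ?(fb1 c2 c4) ?(fb1 c2 c5) ?(fb1 c3 c4) // ?(fb1 c3 c5) //.
rewrite (fb1 c4 c5) ?(fb1 c4 c3) // (fb c2 c3 c4) // (fb c2 c3 c5) //.
rewrite (fb c2 c4 c5) // (fb c3 c4 c5) // (fb c2 c5 c4) // (fb c3 c2 c5) //.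
rewrite !fb1' // => free.
have [] := five_from_zero _ far free; first by split; apply: f_le.
move: (f_le _ s5); clear.
move: (f c2) (f c3) (f c4) (f c5) => d2 d3 d4 d5 d5s.
case/andP=> d4_gt0 d43 /andP[d32 d25] long24 short03 short35.
have d04E : cdist s 0 d4 = d4 by rewrite cdist_le //; lia.
have d02E : cdist s 0 d2 = s - d2 by rewrite cdist_le //; lia.
have d05E : cdist s 0 d5 = s - d5 by rewrite cdist_le //; lia.
have d03E : cdist s 0 d3 = d3 by rewrite cdist_le //; lia.
have d45E : cdist s d4 d5 = s - (d5 - d4) by rewrite cdist_le; lia.
have d42E : cdist s d4 d2 = s - (d2 - d4) by rewrite cdist_le; lia.
have d25E : cdist s d2 d5 = d5 - d2 by rewrite cdist_le; lia.
have d35E : cdist s d3 d5 = d5 - d3 by rewrite cdist_le; lia.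
have d32E : cdist s d3 d2 = d2 - d3 by rewrite cdist_le; lia.
have d43E : cdist s d4 d3 = d3 - d4 by rewrite cdist_le; lia.
rewrite /between !(cdistC s _ 0) (cdistC s d2 d4) (cdistC s d5 d4).
rewrite d04E d02E d05E d03E d45E d42E d25E d35E d32E d43E.
by split; lia.
Qed.

(** * Upper bounds *)

Lemma gp_chain_angles r s t :
  gp_chain r s t -> all (gtn s) [seq p.2 | p <- t].
Proof.
by case=> _ /allP gridt _ _; rewrite all_map; apply/allP=> p /gridt/andP[].
Qed.

(** Each betweenness relation of [five_on_cycle] used here is one that would be
    forbidden if two consecutive points shared their layer. *)
Lemma gp_chain_five r s (p1 p2 p3 p4 p5 : nat * nat) :
  gp_chain r s [:: p1; p2; p3; p4; p5] ->
  (5 <= r) && ((s == 7) || (9 <= s)).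
Proof.
move=> ch.
have [-> _ /andP[b214 b254] b325 b143] :=
  five_on_cycle (gp_chain_angles ch) (gp_chain_betweenless ch).
have sub m := gp_chain_mask m ch.
have [_ t12 _] := gp_chain3 (sub [:: true; true; false; true]).
have [_ t23 _] := gp_chain3 (sub [:: false; true; true; false; true]).
have [_ _ t34] := gp_chain3 (sub [:: true; false; true; true]).
have [_ _ t45] := gp_chain3 (sub [:: false; true; false; true; true]).
have n12 : p1.1 <> p2.1 by move/t12; rewrite b214.
have n23 : p2.1 <> p3.1 by move/t23; rewrite b325.
have n34 : p3.1 <> p4.1 by move/t34; rewrite b143.
have n45 : p4.1 <> p5.1 by move/t45; rewrite b254.
case: ch => _ /and5P[_ _ _ _ /andP[/andP[p5r _] _]] /and5P[].
rewrite /layer_le; lia.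
Qed.

Lemma no_gp_chain_six r s (p1 p2 p3 p4 p5 p6 : nat * nat) :
  ~ gp_chain r s [:: p1; p2; p3; p4; p5; p6].
Proof.
move=> ch; have sub m := gp_chain_mask m ch.
have c1 := sub [:: true; true; true; true; true].
have [_ b415 _ _ _] :=
  five_on_cycle (gp_chain_angles c1) (gp_chain_betweenless c1).
have c2 := sub [:: true; true; false; true; true; true].
have [_ _ _ _ b154] :=
  five_on_cycle (gp_chain_angles c2) (gp_chain_betweenless c2).
have [/negP n156 _ _] :=
  gp_chain3 (sub [:: true; false; false; false; true; true]).
apply/n156/between_end.
have /and5P[s1 _ _ _ /andP[s5 _]] := gp_chain_angles ch.
apply/orP; left; move: b415 b154 s1 s5; rewrite /between /= => b415 b154 s1 s5.
have d15 : cdist s p1.2 p5.2 = 0.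
  move: b415 b154; rewrite (cdistC s p5.2) (cdistC s p4.2 p1.2).
  by move: (cdist s) => d; clear; lia.
by move: d15 s1 s5; rewrite /cdist /pdist; clear; lia.
Qed.

(** The two middle angles avoid both outer ones and each other, so on three
    angles the outer ones coincide. The first two points then lie in different
    layers, and so do the last two. *)
Lemma gp_chain_four_triangle r (p1 p2 p3 p4 : nat * nat) :
  gp_chain r 3 [:: p1; p2; p3; p4] -> 3 <= r.
Proof.
move=> ch; have sub m := gp_chain_mask m ch.
have neq a b c : ~~ between 3 a b c -> b <> a /\ b <> c.
  by move=> nb; split=> e; case/negP: nb;
    apply: between_end; rewrite e eqxx ?orbT.
have [/neq[n21 n23] _ _] := gp_chain3 (sub [:: true; true; true]).
have [/neq[_ n24] t12 _] := gp_chain3 (sub [:: true; true; false; true]).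
have [/neq[n31 n34] _ t34] := gp_chain3 (sub [:: true; false; true; true]).
have /and5P[s1 s2 s3 s4 _] := gp_chain_angles ch.
have e14 : p1.2 = p4.2 by move: s1 s2 s3 s4 => /=; lia.
have n12 : p1.1 <> p2.1.
  by move/t12/negP; apply; apply: between_end; rewrite e14 eqxx orbT.
have n43 : p3.1 <> p4.1.
  by move/t34/negP; apply; apply: between_end; rewrite e14 eqxx.
case: ch => _ /and5P[_ _ _ /andP[p4r _] _] /and4P[].
rewrite /layer_le; lia.
Qed.

(** * Constructions *)

Lemma gp_ge3 : 3 <= gp (cylinder 2 3).
Proof.
apply: (@gp_cylinder_ge 2 3 [:: (0, 0); (0, 1); (0, 2)]) => // u v w.
by rewrite !inE => /or3P[]/eqP-> /or3P[]/eqP-> /or3P[]/eqP->.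
Qed.

Lemma gp_ge4_triangle r : 3 <= r -> 4 <= gp (cylinder r 3).
Proof.
move=> r3.
apply: (@gp_cylinder_ge r 3 [:: (0, 0); (1, 1); (1, 2); (2, 0)]) => //.
  by rewrite /= /in_grid /=; lia.
move=> u v w; rewrite !inE.
by move=> /or4P[]/eqP-> /or4P[]/eqP-> /or4P[]/eqP->.
Qed.

(** Two nearly antipodal points of one layer, and in the next layer the two
    neighbours of the angle 0. *)
Lemma gp_ge4 r s : 2 <= r -> 4 <= s -> 4 <= gp (cylinder r s).
Proof.
move=> r2 s4; pose h := s./2.
have [h_lo h_hi] : s <= 2 * h + 1 /\ 2 * h <= s by lia.
have s3 : 3 <= s by lia.
have d0h : cdist s 0 h = h by rewrite cdist_le //; lia.
have d01 : cdist s 0 1 = 1 by rewrite cdist_le //; lia.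
have d0s : cdist s 0 s.-1 = 1 by rewrite cdist_le //; lia.
have d1h : cdist s 1 h = h.-1 by rewrite cdist_le //; lia.
have dhs : cdist s h s.-1 = s.-1 - h by rewrite cdist_le //; lia.
have d1s : cdist s 1 s.-1 = 2 by rewrite cdist_le //; lia.
have table := (d0h, d01, d0s, d1h, dhs, d1s).
apply: (@gp_cylinder_ge r s [:: (0, 0); (0, h); (1, 1); (1, s.-1)]) => //.
- by rewrite /= !inE !xpair_eqE /=; lia.
- by rewrite /= /in_grid /=; lia.
move=> u v w; rewrite !inE.
move=> /or4P[]/eqP-> /or4P[]/eqP-> /or4P[]/eqP->; rewrite ?eqxx //.
all: move=> _ _ _; rewrite /cyl_dist /pdist /= ?(cdistC s h 0) ?(cdistC s 1 0).
all: rewrite ?(cdistC s _.-1) ?(cdistC s h 1) !table.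
all: clear -s4 h_lo h_hi; lia.
Qed.

(** The pattern of [five_on_cycle]: read in the order of the angles 0, 1, h,
    2h - 1, 2h, the layers are 0, 3, 2, 1, 4. Here h is the largest integer
    below s/2, as both the arc from 0 to h and the arc from h to 2h have to be
    shorter than s/2. *)
Lemma gp_ge5 r s : 5 <= r -> (s == 7) || (9 <= s) -> 5 <= gp (cylinder r s).
Proof.
move=> r5 hs; pose h := s.-1./2.
have s3 : 3 <= s by lia.
have [h_lo h_hi] : s <= 2 * h + 2 /\ 2 * h + 1 <= s by lia.
pose a := (2 * h).-1; pose b := 2 * h.
have d01 : cdist s 0 1 = 1 by rewrite cdist_le //; lia.
have d0h : cdist s 0 h = h by rewrite cdist_le //; lia.
have d0a : cdist s 0 a = s - a by rewrite cdist_le //; lia.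
have d0b : cdist s 0 b = s - b by rewrite cdist_le //; lia.
have d1h : cdist s 1 h = h.-1 by rewrite cdist_le //; lia.
have d1a : cdist s 1 a = (s - a).+1 by rewrite cdist_le; lia.
have d1b : cdist s 1 b = (s - b).+1 by rewrite cdist_le; lia.
have dha : cdist s h a = h.-1 by rewrite cdist_le; lia.
have dhb : cdist s h b = h by rewrite cdist_le; lia.
have dab : cdist s a b = 1 by rewrite cdist_le; lia.
have table := (d01, d0h, d0a, d0b, d1h, d1a, d1b, dha, dhb, dab).
apply: (@gp_cylinder_ge r s [:: (0, 0); (1, a); (2, h); (3, 1); (4, b)]) => //.
- by rewrite /= /in_grid /=; lia.
have sb : b = a.+1 by lia.
have ea : a = h + h.-1 by lia.
have h3 : 3 <= h by lia.
clearbody a b h.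
move=> u v w; rewrite !inE.
move=> /or4P[/eqP->|/eqP->|/eqP->|/orP[]/eqP->].
all: move=> /or4P[/eqP->|/eqP->|/eqP->|/orP[]/eqP->]; rewrite ?eqxx //.
all: move=> /or4P[/eqP->|/eqP->|/eqP->|/orP[]/eqP->]; rewrite ?eqxx //.
all: move=> _ _ _; rewrite /cyl_dist /pdist /=.
all: rewrite ?(cdistC s _ 0) ?(cdistC s h 1) ?(cdistC s a 1) ?(cdistC s b 1).
all: rewrite ?(cdistC s a h) ?(cdistC s b h) ?(cdistC s b a) !table.
all: clear -hs h_lo h_hi sb ea h3; lia.
Qed.

Theorem theorem3p2 (r s : nat) (hr : 2 <= r) (hs : 3 <= s) :
  gp (cart_prod (path_graph r) (cycle_graph s)) =
    if (r == 2) && (s == 3) then 3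
    else if (5 <= r) && ((s == 7) || (9 <= s)) then 5
    else 4.
Proof.
have le5 : gp (cylinder r s) <= 5.
  apply: gp_cylinder_le => // t ch.
  case: t ch => [|p1[|p2[|p3[|p4[|p5[|p6[|??]]]]]]] //.
  by move/no_gp_chain_six.
case: ifP => [/andP[/eqP r2 /eqP s3]|r2s3].
  subst r s; apply/eqP; rewrite eqn_leq gp_ge3 andbT.
  apply: gp_cylinder_le => // t ch.
  case: t ch => [|p1[|p2[|p3[|p4[|??]]]]] //.
  by move/gp_chain_four_triangle.
case: ifP => [/andP[r5 s79]|no5].
  by apply/eqP; rewrite eqn_leq le5 gp_ge5.
apply/eqP; rewrite eqn_leq; apply/andP; split.
  apply: gp_cylinder_le => // t ch.
  case: t ch => [|p1[|p2[|p3[|p4[|p5[|??]]]]]] //.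
  by move/gp_chain_five; rewrite no5.
have [s4|s_le3] := leqP 4 s; first exact: gp_ge4.
have s3 : s = 3 by lia.
by subst s; apply: gp_ge4_triangle; lia.
Qed.
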